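(* Let $p$ be a prime and $r,n\ge1$ integers. Then the symmetrized subfield-trace partition $\mathcal{P}^{\lambda}_{\mathrm{sym},n}$ of $\mathbb{F}_{p^r}^n$ is Fourier-reflexive.
   Context: Let $\operatorname{Tr}:\mathbb{F}_{p^r}\to\mathbb{F}_p$ be the trace. The subfield-trace partition $\mathcal{P}^\lambda$ of $\mathbb{F}_{p^r}$ is $I_0\mid I_1\mid I_2\mid I_3$ with $I_0=\{0\}$, $I_1=\mathbb{F}_p^\times$, $I_2=\{x\in\mathbb{F}_{p^r}\setminus\mathbb{F}_p:\operatorname{Tr}(x)=0\}$, $I_3=\{x\in\mathbb{F}_{p^r}\setminus\mathbb{F}_p:\operatorname{Tr}(x)\ne0\}$ (empty sets are omitted). Given a partition $\mathcal{P}=P_1\mid\cdots\mid P_m$ of a finite abelian group $G$, the induced symmetrized partition $\mathcal{P}_{\mathrm{sym},n}$ of $G^n$ is given by $g\sim g'$ iff $|\{i: g_i\in P_j\}|=|\{i: g'_i\in P_j\}|$ for all $j$. Dual partition: for a finite abelian group $G$ with character group $\widehat G$ and a partition $\mathcal{P}=P_1\mid\cdots\mid P_m$ of $G$, $\widehat{\mathcal{P}}$ is the partition of $\widehat G$ in which $\chi,\chi'$ lie in the same block iff $\sum_{x\in P_i}\chi(x)=\sum_{x\in P_i}\chi'(x)$ for all $i$. $\mathcal{P}$ is Fourier-reflexive if $\widehat{\widehat{\mathcal{P}}}=\mathcal{P}$ under the natural identification $\widehat{\widehat G}=G$. *)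

(* Defs.v *)
From HB Require Import structures.
From mathcomp Require Import all_boot all_order all_fingroup all_algebra.
From mathcomp Require Import all_solvable all_field all_character.

Set Implicit Arguments.
Unset Strict Implicit.
Unset Printing Implicit Defensive.

Import GRing.Theory.
Local Open Scope ring_scope.

(* A finite abelian group is a [finZmodType], which mathcomp also sees as a   *)
(* finite group whose (multiplicatively written) law is the addition. The     *)
(* values of a character are roots of unity, so nothing is lost by taking     *)
(* them in the field algC of complex algebraic numbers.                       *)
Record dual_group (G : finZmodType) : predArgType := DualChar {
  dual_char :> 'CF([set: G]);
  _ : dual_char \is a linear_char
}.

Section DualGroup.

Variable G : finZmodType.
Implicit Types chi psi : dual_group G.

HB.instance Definition _ := [isSub for @dual_char G].
HB.instance Definition _ := [Choice of dual_group G by <:].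

Lemma dual_charP chi : (chi : 'CF([set: G])) \is a linear_char.
Proof. exact: valP. Qed.

Definition dual_of_Iirr (i : Iirr [set: G]) : dual_group G :=
  DualChar (char_abelianP _ (FinRing.zmod_abelian _) i).

Lemma dual_of_IirrK :
  cancel (fun chi => cfIirr (chi : 'CF([set: G]))) dual_of_Iirr.
Proof.
move=> chi; apply: val_inj => /=.
by rewrite cfIirrE // lin_char_irr ?dual_charP.
Qed.

HB.instance Definition _ : isCountable (dual_group G) :=
  CanIsCountable dual_of_IirrK.
HB.instance Definition _ : isFinite (dual_group G) :=
  CanIsFinite dual_of_IirrK.

Definition dual_one : dual_group G := DualChar (cfun1_lin_char [set: G]%G).

Definition dual_mul chi psi : dual_group G :=
  DualChar (rpredM (dual_charP chi) (dual_charP psi)).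

Definition dual_inv chi : dual_group G := DualChar (rpredVr (dual_charP chi)).

Fact dual_mulA : associative dual_mul.
Proof. by move=> chi psi xi; apply: val_inj; apply: mulrA. Qed.

Fact dual_mulC : commutative dual_mul.
Proof. by move=> chi psi; apply: val_inj; apply: mulrC. Qed.

Fact dual_mul1 : left_id dual_one dual_mul.
Proof. by move=> chi; apply: val_inj; apply: mul1r. Qed.

Fact dual_mulV : left_inverse dual_one dual_inv dual_mul.
Proof.
by move=> chi; apply: val_inj; apply/mulVr/lin_char_unitr/dual_charP.
Qed.

(* The law of the dual group is the pointwise product of characters; it is    *)
(* the addition of the [finZmodType] built here.                              *)
HB.instance Definition _ := GRing.isZmodule.Build (dual_group G)
  dual_mulA dual_mulC dual_mul1 dual_mulV.
HB.instance Definition _ := [finGroupMixin of dual_group G for +%R].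

End DualGroup.

Section Evaluation.

Variables (G : finZmodType) (g : G).

Fact eval_subproof :
  is_class_fun <<[set: dual_group G]>>%g
    [ffun chi : dual_group G => (chi : 'CF([set: G])) g].
Proof.
rewrite genGid; apply: intro_class_fun => [chi psi _ _ | chi].
  by rewrite conjgE FinRing.zmod_mulgC mulgK.
by rewrite inE.
Qed.

Definition eval_cfun : 'CF([set: dual_group G]) := Cfun 0 eval_subproof.

Let eval_mx (chi : dual_group G) : 'M[algC]_1 := (chi g)%:M.

Fact eval_mx_repr : mx_repr [set: dual_group G] eval_mx.
Proof.
split=> [|chi psi _ _]; rewrite /eval_mx; first by rewrite /= cfun1E inE.
by rewrite -scalar_mxM /= cfunE.
Qed.

Fact eval_lin_char : eval_cfun \is a linear_char.
Proof.
rewrite qualifE /=; apply/andP; split; last by rewrite cfunE /= cfun1E inE.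
apply/char_reprP; exists (Representation (MxRepresentation eval_mx_repr)).
by apply/cfun_inP=> chi _; rewrite !cfunE inE mulr1n mxtrace_scalar.
Qed.

Definition dual_eval : dual_group (dual_group G) := DualChar eval_lin_char.

End Evaluation.

Definition dual_partition (G : finZmodType) (P : {set {set G}}) :
    {set {set dual_group G}} :=
  equivalence_partition
    (fun chi chi' : dual_group G =>
       [forall B in P, \sum_(x in B) chi x == \sum_(x in B) chi' x])
    [set: dual_group G].

(* [dual_eval] is the natural identification of a finite abelian group with   *)
(* its bidual.                                                                *)
Definition Fourier_reflexive (G : finZmodType) (P : {set {set G}}) : Prop :=
  dual_partition (dual_partition P)
    = [set (@dual_eval G) @: B | B : {set G} in P].

Definition sym_partition (G : finZmodType) (n : nat) (P : {set {set G}}) :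
    {set {set 'rV[G]_n}} :=
  equivalence_partition
    (fun g g' : 'rV[G]_n =>
       [forall B in P,
          #|[set i | g ord0 i \in B]| == #|[set i | g' ord0 i \in B]|])
    [set: 'rV[G]_n].

Section SubfieldTrace.

Variables (p : nat) (F : finFieldType) (pcharFp : p \in [pchar F]).

(* [pPrimeCharType pcharFp] is F viewed as a (splitting field) extension of   *)
(* 'F_p; its least subfield 1 is the prime subfield.                          *)
Local Notation L := (pPrimeCharType pcharFp).

Definition prime_subfield : {set F} := [set x : F | (x : L) \in 1%VS].

(* The trace takes its values in the copy of 'F_p inside F.                   *)
Definition abs_trace (x : F) : F := galTrace 1%AS {:L}%AS (x : L).

Definition subfield_trace_partition : {set {set F}} :=
  [set [set 0];
       prime_subfield :\ 0;
       [set x | (x \notin prime_subfield) && (abs_trace x == 0)];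
       [set x | (x \notin prime_subfield) && (abs_trace x != 0)]] :\ set0.

End SubfieldTrace.

(* Main.v *)
Require Import Defs.
From mathcomp Require Import all_boot all_order all_fingroup all_algebra.
From mathcomp Require Import all_solvable all_field all_character.

(** Every partition below is written as the partition of a finite abelian
    group [G] into the fibres of a map [s] defined on [G], and [G] is identified
    with its dual through a symmetric nondegenerate bicharacter [b].

    If, for this identification, the dual of the fibre partition of [s] is that
    partition itself ([self_dual]), then it is Fourier-reflexive
    ([self_dual_Fourier_reflexive]): by symmetry of [b], the block sums that
    define the bidual partition are the ones that define the dual partition.

    Self-duality passes from [G] to [G^n] with the symmetrized partition, as
    soon as {0} is a block ([self_dual_profile]). For y in G^n, let
    L_y(i) be the linear form in variables indexed by the blocks B whose
    coefficient at B is the sum of b(z, y_i) over z in B. The block sums of the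
    symmetrized partition at y are the coefficients of the product of the forms
    L_y(i), so they only depend on the multiset of the blocks of the y_i.
    Conversely, all these forms have coefficient 1 at the block {0}, so they
    are monic of degree 1 in the variable attached to {0}; by unique
    factorization their product determines their multiset, and self-duality on
    [G] recovers the multiset of blocks ([profile_sum_inj]).

    It remains to see that the subfield-trace partition is self-dual for
    b(x, y) = psi(Tr(xy)), with psi a nontrivial character of the prime field K
    ([self_dual_subfield_trace]). The sums of b(x, y) for x in the groups F, K
    and ker Tr detect y = 0, Tr y = 0 and y in K respectively: K and ker Tr are
    each other's orthogonal for the trace form. The same three conditions define
    the blocks, and the blocks are obtained by differences from F, K, ker Tr,
    {0} and the intersection of K and ker Tr, which is K or {0}. *)

Set Implicit Arguments.
Unset Strict Implicit.
Unset Printing Implicit Defensive.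

Import GRing.Theory Num.Theory.
Local Open Scope ring_scope.

(** * Partitions into fibres *)

Section Kernels.
Variables (T : finType) (S : eqType) (s : T -> S).

Lemma preim_partition_blockP (B : {set T}) :
  reflect (exists x, B = [set y | s y == s x]) (B \in preim_partition s setT).
Proof.
have E x : [set y in [set: T] | s x == s y] = [set y | s y == s x].
  by apply/setP=> y; rewrite !inE eq_sym.
apply: (iffP imsetP) => [[x _ ->]|[x ->]]; exists x => //.
Qed.

Lemma imset_preim_partition (T' : finType) (f : T -> T') (g : T' -> T) :
    cancel f g -> cancel g f ->
  [set f @: (B : {set T}) | B : {set T} in preim_partition s setT]
    = preim_partition (s \o g) setT.
Proof.
move=> fK gK.
have E x : f @: [set y | s y == s x] = [set z | s (g z) == s x].
  apply/setP=> z; rewrite -{1}[z]gK mem_imset ?inE //; exact: can_inj fK.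
apply/setP=> C; apply/imsetP/imsetP => [[B /preim_partition_blockP[x ->] ->]|].
  by exists (f x) => //; rewrite E; apply/setP=> z; rewrite !inE /= fK eq_sym.
case=> z _ ->; exists [set y | s y == s (g z)].
  by apply/preim_partition_blockP; exists (g z).
by rewrite E; apply/setP=> u; rewrite !inE eq_sym.
Qed.

End Kernels.

(** * Dual partitions and self-duality *)

Section Duality.
Variable G : finZmodType.

Lemma card_dual_group : (#|dual_group G| <= #|G|)%N.
Proof.
have cardG : Nirr [set: G] = #|G|.
  rewrite NirrE -cardsT; apply/eqP; rewrite -card_classes_abelian.
  exact: FinRing.zmod_abelian.
rewrite -cardG -[X in (_ <= X)%N]card_ord.
exact: leq_card (can_inj (@dual_of_IirrK G)).
Qed.

Lemma dual_group_exists (h : G -> algC) :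
    h 0 = 1 -> {morph h : x y / x + y >-> x * y} ->
  exists chi : dual_group G, forall x, chi x = h x.
Proof.
move=> h0 hD.
pose h_mx x : 'M[algC]_1 := (h x)%:M.
have h_repr : mx_repr [set: G] h_mx.
  split=> [|x y _ _]; rewrite /h_mx; first by rewrite [h _]h0.
  by rewrite -scalar_mxM -hD.
pose phi := cfRepr (Representation (MxRepresentation h_repr)).
have phiE x : phi x = h x by rewrite cfunE inE mulr1n mxtrace_scalar.
have lin_phi : phi \is a linear_char.
  by rewrite qualifE /= cfRepr_char phiE [h _]h0 eqxx.
by exists (DualChar lin_phi).
Qed.

Variables (H : Type) (beta : H -> dual_group G).
Variable binv : dual_group G -> H.
Hypothesis binvK : cancel binv beta.
Variables (S S' : eqType) (s : G -> S) (t : H -> S').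

(** The block sums [\sum_(x | s x == s x0) beta y x] are those of the dual
    partition; when a map [t] separates exactly the [y] that they separate, the
    dual partition is the one into fibres of [t], read through [beta]. This is
    used for both duals: [beta] is [y |-> b _ y] for the first one and
    [dual_eval] for the second. *)
Lemma dual_preim_partition :
    (forall y y', reflect
      (forall x0, \sum_(x | s x == s x0) beta y x
                  = \sum_(x | s x == s x0) beta y' x)
      (t y == t y')) ->
  dual_partition (preim_partition s setT) = preim_partition (t \o binv) setT.
Proof.
move=> tP; apply: eq_imset => chi; apply/setP=> chi'.
rewrite !inE /=; apply/'forall_implyP/tP; rewrite !binvK => E.
  move=> x0; have /E/eqP : [set y | s y == s x0] \in preim_partition s setT.
    by apply/preim_partition_blockP; exists x0.
  by rewrite !(eq_bigl _ _ (fun x => in_set _ _)).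
move=> _ /preim_partition_blockP[x0 ->].
by rewrite !(eq_bigl _ _ (fun x => in_set _ _)) E.
Qed.
End Duality.

Definition bicharacter (G : finZmodType) (b : G -> G -> algC) :=
  [/\ forall y, b 0 y = 1,
      forall y, {morph b^~ y : x x' / x + x' >-> x * x'},
      forall x y, b x y = b y x
    & forall y y', (forall x, b x y = b x y') -> y = y'].

(** The identification [y |-> b _ y] of [G] with its dual carries the partition
    into fibres of [s] onto its dual partition. *)
Definition self_dual (G : finZmodType) (b : G -> G -> algC)
    (S : eqType) (s : G -> S) :=
  forall y y', reflect
      (forall x0, \sum_(x | s x == s x0) b x y = \sum_(x | s x == s x0) b x y')
      (s y == s y').

(** After the dual partition has been transported to [G], the sum of
    [dual_eval x] over one of its blocks is a sum of [b y x] over a block of [s]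
    in [y]; so the bidual relation between [x] and [x'] is again the one that
    self-duality describes. *)
Lemma self_dual_Fourier_reflexive (G : finZmodType) (b : G -> G -> algC)
    (S : eqType) (s : G -> S) :
    bicharacter b -> self_dual b s ->
  Fourier_reflexive (preim_partition s setT).
Proof.
case=> b0 bD bC b_inj s_dual.
have /fin_all_exists[phi phiE] y :
    exists chi : dual_group G, forall x, chi x = b x y.
  by apply: dual_group_exists; [apply: b0 | apply: bD].
have phi_inj : injective phi.
  by move=> y y' eq_phi; apply: b_inj => x; rewrite -!phiE eq_phi.
have [phi' phiK phi'K] := inj_card_bij phi_inj (card_dual_group G).
have evalE x (chi : dual_group G) : dual_eval x chi = chi x by rewrite cfunE.
have eval_inj : injective (@dual_eval G).
  move=> x x' eq_eval; apply: b_inj => y.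
  by rewrite ![b y _]bC -!phiE -!evalE eq_eval.
have [eval' evalK eval'K] := inj_card_bij eval_inj
  (leq_trans (card_dual_group _) (card_dual_group G)).
have dualE : dual_partition (preim_partition s setT)
    = preim_partition (s \o phi') setT.
  apply: (dual_preim_partition phi'K) => y y'.
  have sumE z x0 : \sum_(x | s x == s x0) phi z x
      = \sum_(x | s x == s x0) b x z.
    by apply: eq_bigr => x _; apply: phiE.
  apply: (iffP (s_dual y y')) => E x0; first by rewrite !sumE.
  by rewrite -!sumE.
rewrite /Fourier_reflexive.
rewrite dualE (imset_preim_partition s evalK eval'K).
apply: (dual_preim_partition eval'K) => x x'.
have sumE z y0 : \sum_(chi | s (phi' chi) == s y0) dual_eval z chi
    = \sum_(y | s y == s y0) b y z.
  rewrite (reindex phi) /=; last by exists phi' => ? _.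
  by under eq_bigl do rewrite phiK; under eq_bigr do rewrite evalE phiE bC.
apply: (iffP (s_dual x x')) => E y0; last by rewrite -!sumE -[y0]phiK E.
by rewrite !sumE E.
Qed.

(** * Character sums and permutations of coordinates *)

(** Equality of the block sums of two functions propagates to all sums weighted
    by a function constant on blocks. Weights in an arbitrary ring [R] let
    generating polynomials of block sums be compared. *)
Lemma eq_weighted_char_sum (G : finZmodType) (S : eqType) (s : G -> S)
    (b b' : G -> algC) (R : nzRingType) (iota : {rmorphism algC -> R})
    (w : G -> R) :
    (forall x0, \sum_(x | s x == s x0) b x = \sum_(x | s x == s x0) b' x) ->
    (forall x x', s x = s x' -> w x = w x') ->
  \sum_x w x * iota (b x) = \sum_x w x * iota (b' x).
Proof.
move=> eq_b w_s.
have E f : \sum_x w x * iota (f x)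
    = \sum_(B in preim_partition s setT) \sum_(x in B) w x * iota (f x).
  rewrite -(set_partition_big _ (preim_partitionP s setT)) /=.
  by apply: eq_bigl => x; rewrite inE.
rewrite !E; apply: eq_bigr => _ /preim_partition_blockP[x0 ->].
rewrite !(eq_bigl _ _ (fun x => in_set _ _)).
have E' f : \sum_(x | s x == s x0) w x * iota (f x)
    = w x0 * iota (\sum_(x | s x == s x0) f x).
  rewrite rmorph_sum mulr_sumr; apply: eq_bigr => x /eqP/w_s -> //.
by rewrite !E' eq_b.
Qed.

(** Translation by [a] in [A] multiplies the sum by [h a], so the sum vanishes
    unless [h] is 1 on [A]. *)
Lemma sum_additive_char (G : finZmodType) (A : {set G}) (h : G -> algC) :
    (forall a x, a \in A -> (a + x \in A) = (x \in A)) ->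
    {morph h : x y / x + y >-> x * y} ->
  \sum_(x in A) h x = if [forall x in A, h x == 1] then #|A|%:R else 0.
Proof.
move=> A_add hD; case: ifPn => [/forall_inP h1 | ].
  by rewrite -sum1_card natr_sum; apply: eq_bigr => x /h1/eqP.
rewrite negb_forall_in => /exists_inP[a Aa ha1].
apply/eqP; have: (h a - 1) * (\sum_(x in A) h x) == 0.
  rewrite mulrBl mul1r subr_eq0 [X in _ == X](reindex_inj (addrI a)) /=.
  rewrite mulr_sumr; apply/eqP; apply: eq_big => [x | x _].
    by rewrite A_add.
  by rewrite hD.
by rewrite mulf_eq0 subr_eq0 (negbTE ha1).
Qed.

Lemma big_row_distr (R : comNzRingType) (T : finType) n (Q : 'I_n -> pred T)
    (F : 'I_n -> T -> R) :
  \prod_i \sum_(z | Q i z) F i z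
    = \sum_(x : 'rV[T]_n | [forall i, Q i (x ord0 i)]) \prod_i F i (x ord0 i).
Proof.
rewrite bigA_distr_big_dep (reindex (fun x : 'rV[T]_n => [ffun i => x ord0 i])).
  apply: eq_big => [x | x _]; last by apply: eq_bigr => i _; rewrite ffunE.
  by apply/familyP/forallP => Qx i; have:= Qx i; rewrite ffunE.
exists (fun f : {ffun 'I_n -> T} => \row_i f i) => [x _ | f _].
  by apply/rowP=> i; rewrite !mxE ffunE.
by apply/ffunP=> i; rewrite ffunE mxE.
Qed.

Lemma perm_mktupleP (T : eqType) n (f g : 'I_n -> T) :
  reflect (exists sigma : 'S_n, forall i, f i = g (sigma i))
          (perm_eq [tuple f i | i < n] [tuple g i | i < n]).
Proof.
apply: (iffP tuple_permP) => -[sigma E]; exists sigma.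
  move=> i; have {}E : [tuple f i | i < n]
      = [tuple tnth [tuple g i | i < n] (sigma i) | i < n] by apply: val_inj.
  by have:= congr1 (fun t => tnth t i) E; rewrite !tnth_mktuple.
congr val; apply/eq_from_tnth => i.
by rewrite !tnth_mktuple.
Qed.

(** * Symmetrized partitions *)

Section Symmetrize.
Variables (G : finZmodType) (n : nat).

Section Profile.
Variables (S : finType) (s : G -> S).

Definition profile (x : 'rV[G]_n) : {ffun S -> nat} :=
  [ffun c => #|[set i | s (x ord0 i) == c]|].

(** Vectors with the same profile differ by a permutation of the coordinates, up
    to replacing coordinates inside their blocks. *)
Lemma profileP (x y : 'rV[G]_n) :
  reflect (exists sigma : 'S_n, forall i, s (x ord0 i) = s (y ord0 (sigma i)))
          (profile x == profile y).
Proof.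
have countE (z : 'rV[G]_n) c :
    count_mem c [tuple s (z ord0 i) | i < n] = profile z c.
  rewrite ffunE cardE /enum_mem size_filter /= count_map enumT.
  by apply: eq_count => i; rewrite !inE.
suff -> : (profile x == profile y)
    = perm_eq [tuple s (x ord0 i) | i < n] [tuple s (y ord0 i) | i < n].
  exact: perm_mktupleP.
apply/eqP/idP => [E | /seq.permP E].
  by apply/allP => c _ /=; rewrite !countE E.
by apply/ffunP=> c; rewrite -!countE E.
Qed.

Lemma sym_preim_partition :
  sym_partition n (preim_partition s setT) = preim_partition profile setT.
Proof.
have countE (x : 'rV[G]_n) c :
    #|[set i | x ord0 i \in [set z | s z == c]]| = profile x c.
  by rewrite ffunE; apply: eq_card => i; rewrite !inE.
apply: eq_imset => x; apply/setP=> y; rewrite !inE /=.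
apply/'forall_implyP/eqP=> [E | /ffunP E].
  apply/ffunP=> c; case: (pickP (fun z => s z == c)) => [z0 /eqP <- | no_z].
    have /E/eqP: [set z | s z == s z0] \in preim_partition s setT.
      by apply/preim_partition_blockP; exists z0.
    by rewrite !countE.
  by rewrite !ffunE !eq_card0 // => i; rewrite inE no_z.
move=> _ /preim_partition_blockP[z0 ->]; apply/eqP.
by rewrite !countE E.
Qed.
End Profile.

Variable b : G -> G -> algC.
Definition prod_bichar (x y : 'rV[G]_n) := \prod_i b (x ord0 i) (y ord0 i).

Hypothesis bP : bicharacter b.

Lemma bicharacter_prod : bicharacter prod_bichar.
Proof.
have [b0 bD bC b_inj] := bP; split=> [y | y x x' | x y | y y' eq_y].
- by rewrite /prod_bichar big1 // => i _; rewrite mxE b0.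
- by rewrite /prod_bichar -big_split; apply: eq_bigr => i _; rewrite mxE bD.
- by apply: eq_bigr => i _; rewrite bC.
apply/rowP => i; apply: b_inj => z.
have:= eq_y (\row_j if j == i then z else 0); rewrite /prod_bichar.
rewrite (bigD1 i) //= [RHS](bigD1 i) //= !big1 ?mxE ?eqxx ?mulr1 // => j;
  move=> /negbTE ji; by rewrite mxE ji b0.
Qed.

Variables (S : finType) (s : G -> S).
Hypothesis s_dual : self_dual b s.
Hypothesis s0 : forall x, s x = s 0 -> x = 0.

Lemma fiber_sum_eq y y' c : s y = s y' ->
  \sum_(x | s x == c) b x y = \sum_(x | s x == c) b x y'.
Proof.
move/eqP/s_dual=> E; case: (pickP (fun x => s x == c)) => [x0 /eqP <- //|no_x].
by rewrite !big_pred0.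
Qed.

(** Two elementary moves lead from [y] to [y']: replacing coordinates inside
    their blocks, harmless because the vectors [x] with prescribed blocks of
    coordinates contribute a product of block sums over [G]; and permuting the
    coordinates, harmless because a block of the profile is stable under
    permutations. *)
Lemma profile_sum_eq (x0 y y' : 'rV[G]_n) : profile s y = profile s y' ->
  \sum_(x | profile s x == profile s x0) prod_bichar x y
    = \sum_(x | profile s x == profile s x0) prod_bichar x y'.
Proof.
move/eqP/profileP=> [sigma ys].
pose y'' := col_perm sigma y'.
transitivity (\sum_(x | profile s x == profile s x0) prod_bichar x y'').
  (* Grouping the x by the word of the blocks of their coordinates. *)
  pose letters (x : 'rV[G]_n) := [ffun i => s (x ord0 i)].
  rewrite !(partition_big letters predT) //=; apply: eq_bigr => beta _.
  have E u : \sum_(x | (profile s x == profile s x0) && (letters x == beta))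
       prod_bichar x u =
    if [ffun c => #|[set i | beta i == c]|] == profile s x0 then
       \prod_i \sum_(z | s z == beta i) b z (u ord0 i) else 0.
    case: ifPn => [beta_x0 | beta_x0].
      rewrite big_row_distr; apply: eq_bigl => x.
      apply/andP/forallP=> [[_ /eqP/ffunP lx] i | lx].
        by rewrite -lx ffunE.
      have {}lx : letters x = beta.
        by apply/ffunP=> i; rewrite ffunE (eqP (lx i)).
      split; last by rewrite lx.
      apply/eqP; apply: etrans (eqP beta_x0); apply/ffunP => c.
      by rewrite !ffunE -lx; apply: eq_card => i; rewrite !inE ffunE.
    rewrite big_pred0 // => x.
    apply: contraNF beta_x0 => /andP[/eqP xx0 /eqP lx].
    apply/eqP; apply: etrans xx0; apply/ffunP => c.
    by rewrite !ffunE -lx; apply: eq_card => i; rewrite !inE ffunE.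
  rewrite !E; case: ifP => // _; apply: eq_bigr => i _.
  by apply: fiber_sum_eq; rewrite mxE ys.
rewrite (reindex (col_perm sigma)) /=; last first.
  exists (col_perm sigma^-1%g) => x _.
    by rewrite -col_permM mulVg col_perm1.
  by rewrite -col_permM mulgV col_perm1.
apply: eq_big => [x | x _].
  congr (_ == _); apply/eqP/profileP; exists sigma => i; by rewrite mxE.
rewrite /prod_bichar [RHS](reindex_inj (@perm_inj _ sigma)).
by apply: eq_bigr => i _; rewrite !mxE.
Qed.

(** Unique factorization of the product of the linear forms. Their variables are
    specialized in [{poly K}], where [K] contains [{poly algC}]: up to sign, to
    distinct powers of the variable of [{poly algC}], with ['X] added for the
    block {0}. No information is lost, since a linear form can be read off from
    its coefficients on these powers. The form attached to [u] in [G] becomes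
    ['X - e (A u)], so that equality of the products is equality of the
    multisets of the roots [e (A (y ord0 i))]. *)
Lemma profile_sum_inj (y y' : 'rV[G]_n) :
    (forall x0, \sum_(x | profile s x == profile s x0) prod_bichar x y
              = \sum_(x | profile s x == profile s x0) prod_bichar x y') ->
  profile s y = profile s y'.
Proof.
have [b0 bD bC b_inj] := bP; move=> eq_y.
have [K [e e_inj]] : exists (K : fieldType) (e : {rmorphism {poly algC} -> K}),
    injective e.
  exists {fraction {poly algC}}, (@tofrac _) => P Q /eqP.
  by rewrite tofrac_eq => /eqP.
have [iota iotaE] : exists iota : {rmorphism algC -> {poly K}},
    forall c, iota c = (e c%:P)%:P.
  by exists (polyC \o (e \o polyC)).
pose A u : {poly algC} := \sum_z b z u *: 'X^(enum_rank (s z)).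
(* [w z] is the value at [z] of the generic function on [G] constant on blocks;
   'X only appears at 0, which is allowed because {0} is a block. *)
pose w z : {poly K} := 'X *+ (z == 0) - (e 'X^(enum_rank (s z)))%:P.
pose W (x : 'rV[G]_n) := \prod_i w (x ord0 i).
have w_s z z' : s z = s z' -> w z = w z'.
  move=> eq_s; rewrite /w eq_s; congr (_ *+ nat_of_bool _ - _).
  by apply/eqP/eqP=> z0; apply: s0; [rewrite -eq_s | rewrite eq_s]; rewrite z0.
have W_s (x x' : 'rV[G]_n) : profile s x = profile s x' -> W x = W x'.
  move/eqP/profileP=> [sigma sx].
  rewrite [RHS](reindex_inj (@perm_inj _ sigma)).
  by apply: eq_bigr => i _; apply: w_s.
have sum1 u : \sum_z w z * iota (b z u) = 'X - (e (A u))%:P.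
  rewrite /w; under eq_bigr do rewrite mulrBl.
  rewrite sumrB (bigD1 0) //= b0 rmorph1 mulr1 big1 ?addr0 => [|z /negbTE->].
    congr (_ - _); first by rewrite eqxx.
    rewrite /A 2!rmorph_sum; apply: eq_bigr => z _.
    by rewrite iotaE -mul_polyC mulrC -!rmorphM.
  by rewrite mul0r.
have prodE (u : 'rV[G]_n) :
    \prod_(a <- [tuple e (A (u ord0 i)) | i < n]) ('X - a%:P)
    = \sum_x W x * iota (prod_bichar x u).
  rewrite big_map /= big_enum /=.
  under eq_bigr do rewrite -sum1.
  rewrite big_row_distr; apply: eq_big => [x|x _]; first by apply/forallP.
  by rewrite /W /prod_bichar (rmorph_prod iota) -big_split.
have /prod_XsubC_eq/perm_mktupleP[sigma eqA] := etrans (prodE y)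
  (etrans (eq_weighted_char_sum iota eq_y W_s) (esym (prodE y'))).
apply/eqP/profileP; exists sigma => i; apply/eqP/s_dual => x0.
have {}eqA : A (y ord0 i) = A (y' ord0 (sigma i)) by apply: e_inj; apply: eqA.
have coefA u : (A u)`_(enum_rank (s x0)) = \sum_(x | s x == s x0) b x u.
  rewrite coef_sum [RHS]big_mkcond; apply: eq_bigr => x _ /=.
  rewrite coefZ coefXn val_eqE (inj_eq enum_rank_inj) eq_sym.
  by case: eqP => _; rewrite ?mulr1 ?mulr0.
by rewrite -!coefA eqA.
Qed.

Lemma self_dual_profile : self_dual prod_bichar (profile s).
Proof.
move=> y y'; apply: (iffP eqP) => [yy' x0 |]; first exact: profile_sum_eq.
exact: profile_sum_inj.
Qed.

End Symmetrize.

(** * The prime subfield and the absolute trace *)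

Section SubfieldTracePartition.
Variables (p : nat) (F : finFieldType) (pcharFp : p \in [pchar F]).
Local Notation L := (pPrimeCharType pcharFp).
Local Notation K := (prime_subfield pcharFp).
Local Notation Tr := (abs_trace pcharFp).

Lemma prime_subfieldE (x : F) : (x \in K) = ((x : L) \in 1%VS).
Proof. exact: in_set. Qed.

Lemma prime_subfield0 : 0 \in K.
Proof. by rewrite inE mem0v. Qed.

Lemma prime_subfield1 : 1 \in K.
Proof. by rewrite inE (mem1v (1%AS : {subfield L})). Qed.

Lemma prime_subfieldV c : c \in K -> c^-1 \in K.
Proof. by rewrite !inE => Kc; rewrite (memvV (1%AS : {subfield L})). Qed.

Lemma prime_subfieldM c d : c \in K -> d \in K -> c * d \in K.
Proof. by rewrite !inE => Kc Kd; apply: (@memvM _ L 1%AS). Qed.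

Lemma prime_subfield_addl c x : c \in K -> (c + x \in K) = (x \in K).
Proof. by rewrite !inE => Kc; apply: rpredDl. Qed.

Lemma abs_traceD : {morph Tr : x y / x + y}.
Proof. exact: (raddfD (@galTrace _ L 1 fullv)). Qed.

Lemma abs_traceB : {morph Tr : x y / x - y}.
Proof. exact: (raddfB (@galTrace _ L 1 fullv)). Qed.

Lemma abs_trace_mem x : Tr x \in K.
Proof.
rewrite inE; apply: mem_galTrace (memvf _); apply: finField_galois.
exact: subvf.
Qed.

Lemma abs_traceZ c x : c \in K -> Tr (c * x) = c * Tr x.
Proof.
rewrite inE => Kc; rewrite /abs_trace /galTrace mulr_sumr.
apply: eq_bigr => u Gu; rewrite rmorphM; congr (_ * _).
exact: fixed_gal (sub1v _) Gu Kc.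
Qed.

(** Linear independence of the Galois automorphisms: their sum is not zero. *)
Lemma abs_trace_neq0 : exists x, Tr x != 0.
Proof.
apply/existsP; apply: contraT; rewrite negb_exists => /forallP Tr0.
have Tr_eq0 (a : L) : a \in (fullv : {vspace L}) ->
    \sum_(u in 'Gal({:L} / 1)%g) (1 : L) * u a = 0.
  move=> _; apply: etrans (eqP (negbNE (Tr0 a))).
  by apply: eq_bigr => u _; apply: mul1r.
have Gal1 : 1%g \in 'Gal({:L} / 1)%g by apply: group1.
have := gal_independent Tr_eq0 Gal1.
by move/eqP; rewrite (negbTE (oner_neq0 L)).
Qed.

(** The character of 'F_p sending 1 to a primitive root of unity zeta of order
    p. The exponent of zeta is the representative in nat of an element of 'F_p,
    and the order of zeta is written as the modulus in the definition of 'F_p,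
    so that additivity is reduction of exponents. *)
Lemma prime_subfield_char_exists : exists psi : F -> algC,
  [/\ psi 0 = 1, {in K &, {morph psi : x y / x + y >-> x * y}} & psi 1 != 1].
Proof.
have [zeta zetaP] := C_prim_root_exists (ltn0Sn (Zp_trunc (pdiv p)).+1).
have /fin_all_exists[k kP] (x : F) : exists k : 'F_p, x \in K -> x = (k%:A : L).
  case: (boolP (x \in K)) => [Kx | nKx]; last by exists 0.
  move: (Kx); rewrite prime_subfieldE => /vlineP[k xk]; exists k => _.
  exact: xk.
have A_inj : injective (fun k : 'F_p => k%:A : L).
  move=> u v /eqP; rewrite -subr_eq0 -scalerBl scaler_eq0 oner_eq0 orbF.
  by rewrite subr_eq0 => /eqP.
have k0 : k 0 = 0.
  by apply: A_inj; rewrite -kP ?prime_subfield0 // scale0r.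
have k1 : k 1 = 1.
  by apply: A_inj; rewrite -kP ?prime_subfield1 // scale1r.
exists (fun x => zeta ^+ (k x)); split=> [|x y Kx Ky|]; first by rewrite k0.
  have -> : k (x + y) = k x + k y.
    apply: A_inj; rewrite -kP ?prime_subfield_addl //.
    by rewrite scalerDl -!kP.
  by rewrite -exprD -(prim_expr_mod zetaP (k x + k y)).
by rewrite k1 -(prim_order_dvd zetaP).
Qed.

(** * Self-duality of the subfield-trace partition *)

Definition subfield_trace_sig (x : F) : bool * bool * bool :=
  (x == 0, x \in K, Tr x == 0).
Local Notation sig := subfield_trace_sig.

Lemma abs_trace0 : Tr 0 = 0.
Proof. by rewrite -[0](mul0r 0) abs_traceZ ?mul0r ?prime_subfield0. Qed.

(** The trace vanishes on all of K or only at 0, since it is K-linear; hence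
    K minus 0 is a single fibre of [subfield_trace_sig]. *)
Lemma abs_trace_subfield_eq0 x : x \in K -> x != 0 -> (Tr x == 0) = (Tr 1 == 0).
Proof.
by move=> Kx x0; rewrite -[x]mulr1 abs_traceZ // mulf_eq0 (negbTE x0).
Qed.

Lemma subfield_trace_fiber x0 : [set x | sig x == sig x0] =
  if x0 == 0 then [set 0] else if x0 \in K then K :\ 0
  else if Tr x0 == 0 then [set x | (x \notin K) && (Tr x == 0)]
  else [set x | (x \notin K) && (Tr x != 0)].
Proof.
apply/setP=> x; rewrite in_set !xpair_eqE.
have [-> | nz0] := eqVneq x0 0.
  rewrite in_set1; have [-> | //] := eqVneq x 0.
  by rewrite !eqxx.
have [Kx0 | nKx0] := boolP (x0 \in K).
  rewrite in_setD1 (abs_trace_subfield_eq0 Kx0 nz0).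
  have [// | nz] := eqVneq x 0; case: (boolP (x \in K)) => // Kx.
  by rewrite (abs_trace_subfield_eq0 Kx nz) !eqxx.
have [-> | nz] := eqVneq x 0; first by
  case: ifP; rewrite in_set prime_subfield0.
by case: (Tr x0 == 0); rewrite in_set; case: (x \in K); case: (Tr x == 0).
Qed.

Lemma subfield_trace_partitionE :
  subfield_trace_partition pcharFp = preim_partition sig setT.
Proof.
apply/setP=> B; rewrite in_setD1.
apply/andP/preim_partition_blockP=> [[/set0Pn[x0 Bx0] B_in] | [x0 ->]].
  exists x0; rewrite subfield_trace_fiber.
  move: B_in; rewrite !in_setU !in_set1 -!orbA.
  case/or4P=> /eqP BE; move: Bx0; rewrite BE.
  - by rewrite in_set1 => ->.
  - by rewrite in_setD1 => /andP[/negbTE-> ->].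
  - rewrite in_set => /andP[nK ->]; rewrite (negbTE nK) ifN //.
    by apply: contraNneq nK => ->; apply: prime_subfield0.
  - rewrite in_set => /andP[nK /negbTE->]; rewrite (negbTE nK) ifN //.
    by apply: contraNneq nK => ->; apply: prime_subfield0.
split; first by apply/set0Pn; exists x0; rewrite in_set.
rewrite subfield_trace_fiber !in_setU !in_set1.
by do 3?[case: ifP => _]; rewrite eqxx ?orbT.
Qed.

Variable psi : F -> algC.
Hypotheses (psi0 : psi 0 = 1) (psi1 : psi 1 != 1)
  (psiD : {in K &, {morph psi : x y / x + y >-> x * y}}).

Definition trace_pairing (x y : F) := psi (Tr (x * y)).
Local Notation b := trace_pairing.

Lemma trace_pairingDl y : {morph b^~ y : x x' / x + x' >-> x * x'}.
Proof. by move=> x x'; rewrite /b mulrDl abs_traceD psiD ?abs_trace_mem. Qed.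

Lemma trace_pairing_subfield y :
  [forall x in K, b x y == 1] = (Tr y == 0).
Proof.
apply/forall_inP/eqP=> [b1 | Try0 x Kx]; last first.
  by rewrite /b abs_traceZ // Try0 mulr0 psi0.
apply: contraTeq isT => Try; have KV := prime_subfieldV (abs_trace_mem y).
by have:= b1 _ KV; rewrite /b abs_traceZ // mulVf // (negbTE psi1).
Qed.

Lemma trace_form_nondeg y : (forall x, Tr (x * y) = 0) -> y = 0.
Proof.
move=> y0; have [x Trx] := abs_trace_neq0.
apply: contraNeq Trx => nz_y; rewrite -(y0 (x / y)) divfK //.
Qed.

Lemma trace_pairing_all y : [forall x in [set: F], b x y == 1] = (y == 0).
Proof.
apply/forall_inP/eqP=> [b1 | -> x _]; last by rewrite /b mulr0 abs_trace0 psi0.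
apply: trace_form_nondeg => x; apply/eqP; rewrite -trace_pairing_subfield.
by apply/forall_inP=> c _; have:= b1 (c * x); rewrite /b mulrA; apply.
Qed.

Definition trace_kernel : {set F} := [set x | Tr x == 0].

Lemma in_trace_kernel x : (x \in trace_kernel) = (Tr x == 0).
Proof. exact: in_set. Qed.

(** The orthogonal of ker Tr for the trace form is K. If y is orthogonal to
    ker Tr, then x |-> Tr (x * y) vanishes on the kernel of x |-> Tr x, so it is
    c * Tr x = Tr (x * c) for a constant c in K; nondegeneracy gives y = c. *)
Lemma trace_pairing_kernel y :
  [forall x in trace_kernel, b x y == 1] = (y \in K).
Proof.
apply/forall_inP/idP=> [b1 | Ky x]; last first.
  by rewrite in_set => /eqP Trx; rewrite /b mulrC abs_traceZ // Trx mulr0 psi0.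
have Try x : Tr x = 0 -> Tr (x * y) = 0.
  move=> Trx; apply/eqP; rewrite -trace_pairing_subfield.
  apply/forall_inP=> c Kc.
  by rewrite /b mulrA; apply: b1; rewrite in_set abs_traceZ // Trx mulr0.
have [x1 Trx1] := abs_trace_neq0.
pose c := Tr (x1 * y) / Tr x1.
have Kc : c \in K by rewrite prime_subfieldM ?prime_subfieldV ?abs_trace_mem.
suff /subr0_eq-> : y - c = 0 by [].
apply: trace_form_nondeg => x.
(* x - d * x1 is the projection of x on ker Tr along x1. *)
pose d := Tr x / Tr x1.
have Kd : d \in K by rewrite prime_subfieldM ?prime_subfieldV ?abs_trace_mem.
have /Try : Tr (x - d * x1) = 0.
  by rewrite abs_traceB (abs_traceZ _ Kd) divfK // subrr.
rewrite mulrBl -mulrA !abs_traceB (abs_traceZ _ Kd) mulrBr abs_traceB.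
rewrite [x * c]mulrC (abs_traceZ _ Kc) => E.
by rewrite -E; congr (_ - _); rewrite /c /d mulrAC [RHS]mulrAC [Tr x * _]mulrC.
Qed.

Lemma trace_pairing_bichar : bicharacter b.
Proof.
split=> [y | y | x y | y y' eq_b]; first by rewrite /b mul0r abs_trace0 psi0.
- exact: trace_pairingDl.
- by rewrite /b mulrC.
apply/eqP; rewrite -subr_eq0 -trace_pairing_all; apply/forall_inP => x _.
have bDr u v : b x (u + v) = b x u * b x v.
  by rewrite /b mulrDr abs_traceD psiD ?abs_trace_mem.
by rewrite bDr eq_b -bDr subrr /b mulr0 abs_trace0 psi0.
Qed.

Lemma sum_trace_pairing_all y :
  \sum_(x in [set: F]) b x y = (#|[set: F]| * (y == 0))%:R.
Proof.
rewrite (sum_additive_char _ (trace_pairingDl y)) => [|a x _]; last first.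
  by rewrite !in_setT.
by rewrite trace_pairing_all; case: eqP; rewrite ?muln1 ?muln0.
Qed.

Lemma sum_trace_pairing_subfield y :
  \sum_(x in K) b x y = (#|K| * (Tr y == 0))%:R.
Proof.
rewrite (sum_additive_char _ (trace_pairingDl y)) => [|a x]; last first.
  exact: prime_subfield_addl.
by rewrite trace_pairing_subfield; case: eqP; rewrite ?muln1 ?muln0.
Qed.

Lemma sum_trace_pairing_kernel y :
  \sum_(x in trace_kernel) b x y = (#|trace_kernel| * (y \in K))%:R.
Proof.
rewrite (sum_additive_char _ (trace_pairingDl y)) => [|a x]; last first.
  by rewrite !in_set abs_traceD => /eqP ->; rewrite add0r.
by rewrite trace_pairing_kernel; case: (y \in K); rewrite ?muln1 ?muln0.
Qed.

(** Each block is obtained by differences of nested sets from F, K, ker Tr,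
    {0} and the intersection of K with ker Tr, which is K or {0}; the sums of
    the pairing over these are functions of the signature of y. Conversely F, K
    and ker Tr are unions of blocks, so the block sums determine the sums over
    these groups, hence the signature. *)
Lemma self_dual_subfield_trace : self_dual b sig.
Proof.
have zeroK : 0 \in trace_kernel by rewrite in_set abs_trace0.
move=> y y'; apply: (iffP eqP) => [[ey eK eTr] x0 | eq_sum].
  pose good (B : {set F}) := \sum_(x in B) b x y = \sum_(x in B) b x y'.
  have goodD B C : good B -> good C -> C \subset B -> good (B :\: C).
    rewrite /good => gB gC sCB; apply: (addrI (\sum_(x in C) b x y)).
    have split_sum u : \sum_(x in B) b x u
        = \sum_(x in C) b x u + \sum_(x in B :\: C) b x u.
      by rewrite (big_setID C) /= (setIidPr sCB).
    by rewrite -split_sum gB gC -split_sum.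
  have gF : good setT by rewrite /good !sum_trace_pairing_all ey.
  have gK : good K by rewrite /good !sum_trace_pairing_subfield eTr.
  have gH : good trace_kernel by rewrite /good !sum_trace_pairing_kernel eK.
  have g0 : good [set 0] by rewrite /good !big_set1 /b !mul0r.
  have gKH : good (K :&: trace_kernel).
    have [Tr1 | Tr1] := eqVneq (Tr 1) 0.
      rewrite (setIidPl _) //; apply/subsetP=> x Kx.
      by rewrite in_set -[x]mulr1 abs_traceZ // Tr1 mulr0.
    suff -> : K :&: trace_kernel = [set 0] by [].
    apply/setP=> x; rewrite in_setI in_set1 [x \in trace_kernel]in_set.
    have [-> | nz] := eqVneq x 0.
      by rewrite prime_subfield0 abs_trace0 eqxx.
    case: (boolP (x \in K)) => //= Kx.
    by rewrite abs_trace_subfield_eq0 // (negbTE Tr1).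
  suff : good [set x | sig x == sig x0].
    by rewrite /good !(eq_bigl _ _ (fun x => in_set _ _)).
  rewrite subfield_trace_fiber; case: ifP => _ //; case: ifP => _.
    by apply: goodD => //; rewrite sub1set prime_subfield0.
  case: ifP => _.
    suff -> : [set x | (x \notin K) && (Tr x == 0)]
        = trace_kernel :\: (K :&: trace_kernel).
      by apply: goodD => //; apply: subsetIr.
    by apply/setP=> x; rewrite [LHS]in_set !(in_setD, in_setI, in_setT);
      rewrite in_trace_kernel; case: (Tr x == 0); case: (x \in K).
  suff -> : [set x | (x \notin K) && (Tr x != 0)]
      = (setT :\: trace_kernel) :\: (K :\: (K :&: trace_kernel)).
    apply: (goodD); [by apply: (goodD) | |].
      by apply: (goodD) => //; apply: subsetIl.
    by apply/subsetP=> x;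
      rewrite !(in_setD, in_setI, in_setT) in_trace_kernel;
      case: (Tr x == 0); case: (x \in K).
  by apply/setP=> x; rewrite [LHS]in_set !(in_setD, in_setI, in_setT);
      rewrite in_trace_kernel; case: (Tr x == 0); case: (x \in K).
have eq_on (B : {set F}) :
    (forall x x', sig x = sig x' -> (x \in B) = (x' \in B)) ->
    \sum_(x in B) b x y = \sum_(x in B) b x y'.
  move=> Bsig; pose w x : algC := (x \in B)%:R.
  have E u : \sum_(x in B) b x u = \sum_x w x * idfun (b x u).
    rewrite big_mkcond; apply: eq_bigr => x _; rewrite /w.
    by case: (x \in B); rewrite ?mul1r ?mul0r.
  rewrite !E; apply: eq_weighted_char_sum eq_sum _ => x x' /Bsig.
  by rewrite /w => ->.
have cancel_card (B : {set F}) (u v : bool) : 0 \in B ->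
  (#|B| * u)%:R = (#|B| * v)%:R :> algC -> u = v.
  move=> B0 /eqP; rewrite eqr_nat eqn_pmul2l ?card_gt0; last first.
    by apply/set0Pn; exists 0.
  by case: u v => -[].
congr (_, _, _).
- apply: (cancel_card [set: F]); first exact: in_setT.
  by rewrite -!sum_trace_pairing_all; apply: eq_on => x x' _; rewrite !in_setT.
- apply: (cancel_card trace_kernel) => //.
  rewrite -!sum_trace_pairing_kernel; apply: eq_on => x x' [_ _ E].
  by rewrite !in_trace_kernel.
apply: (cancel_card K); first exact: prime_subfield0.
by rewrite -!sum_trace_pairing_subfield; apply: eq_on => x x' [].
Qed.
End SubfieldTracePartition.

(** * Fourier-reflexivity *)

Theorem proposition32 (p r n : nat) (p_prime : prime p)
    (r_gt0 : (0 < r)%N) (n_gt0 : (0 < n)%N)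
    (F : finFieldType) (cardF : #|F| = (p ^ r)%N) (pcharFp : p \in [pchar F]) :
  Fourier_reflexive (sym_partition n (subfield_trace_partition pcharFp)).
Proof.
have [psi [psi0 psiD psi1]] := prime_subfield_char_exists pcharFp.
have sig0 x :
    subfield_trace_sig pcharFp x = subfield_trace_sig pcharFp 0 -> x = 0.
  by case; rewrite eqxx => /eqP.
have b_bichar := trace_pairing_bichar psi0 psi1 psiD.
have s_dual := self_dual_subfield_trace psi0 psi1 psiD.
rewrite subfield_trace_partitionE sym_preim_partition.
apply: self_dual_Fourier_reflexive (bicharacter_prod n b_bichar) _.
exact: (self_dual_profile b_bichar s_dual sig0).
Qed.
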